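(* Let $A$ be a basic finite dimensional algebra over a field $k$ with complete set of orthogonal primitive idempotents $1=e_1+\cdots+e_n$, and let $\epsilon\in\{\pm1\}^n$. Then the isomorphism $K_0(\operatorname{proj}A_\epsilon)_{\mathbb R}\simeq K_0(\operatorname{proj}A)_{\mathbb R}$ induced by $-\otimes_{A_\epsilon}A$ (so $[e_iA_\epsilon]\mapsto[e_iA]$) gives an isomorphism of fans $\Sigma_\epsilon(A_\epsilon)\simeq\Sigma_\epsilon(A)$.
   Context: $e^+_\epsilon:=\sum_{\epsilon_i=1}e_i$, $e^-_\epsilon:=\sum_{\epsilon_i=-1}e_i$, and $A_\epsilon$ is the subalgebra $\begin{pmatrix}e^+_\epsilon Ae^+_\epsilon&e^+_\epsilon Ae^-_\epsilon\\0&e^-_\epsilon Ae^-_\epsilon\end{pmatrix}$ of $A$; the $e_i$ also form a complete set of orthogonal primitive idempotents of $A_\epsilon$. For an algebra $\Lambda$ with such idempotents $e_i$: 2-term presilting complexes in $\mathsf{K}^{\rm b}(\operatorname{proj}\Lambda)$ are complexes concentrated in degrees $-1,0$ with $\operatorname{Hom}(T,T[\ell])=0$ for $\ell>0$; for basic such $T=T_1\oplus\cdots\oplus T_j$ ($T_i$ indecomposable), $C(T)=\{\sum a_i[T_i]\mid a_i\ge0\}$; $\Sigma(\Lambda)$ is the set of all these cones; the orthant is $K_0(\operatorname{proj}\Lambda)_{\epsilon,\mathbb R}=\operatorname{cone}\{\epsilon_i[e_i\Lambda]\mid 1\le i\le n\}$ and $\Sigma_\epsilon(\Lambda):=\{\sigma\in\Sigma(\Lambda)\mid\sigma\subset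 K_0(\operatorname{proj}\Lambda)_{\epsilon,\mathbb R}\}$. An isomorphism of fans is a lattice isomorphism whose linear extension maps cones bijectively to cones. *)

(* Defs.v *)
From HB Require Import structures.
From mathcomp Require Import all_boot all_order all_algebra all_field.
From mathcomp Require Import boolp classical_sets reals.
Set Implicit Arguments. Unset Strict Implicit. Unset Printing Implicit Defensive.
Import GRing.Theory Num.Theory.
Local Open Scope ring_scope.
Local Open Scope classical_set_scope.

Section AlgebraNotions.
Variables (F : fieldType) (A : falgType F) (n : nat) (e : 'I_n -> A).

Definition idempotent (x : A) := x * x = x.

Definition primitive_idem (x : A) :=
  idempotent x /\ x <> 0 /\
  forall f g : A, idempotent f -> idempotent g -> f * g = 0 -> g * f = 0 ->
    x = f + g -> f = 0 \/ g = 0.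

Definition complete_orth_prim :=
  \sum_(i < n) e i = 1 /\
  (forall i j, i != j -> e i * e j = 0) /\
  (forall i, primitive_idem (e i)).

(* A basic: the e_i A are pairwise non-isomorphic right A-modules.
   Hom_A(e_i A, e_j A) = e_j A e_i (left multiplication). *)
Definition basic_alg :=
  forall i j : 'I_n,
    (exists a b : A, e j * a * e i = a /\ e i * b * e j = b /\
                     b * a = e i /\ a * b = e j) -> i = j.

Definition eplus (eps : 'I_n -> int) := \sum_(i < n | eps i == 1) e i.
Definition eminus (eps : 'I_n -> int) := \sum_(i < n | eps i == -1) e i.

(* the subalgebra A_eps = [[e+Ae+, e+Ae-],[0, e-Ae-]] = {a | e- a e+ = 0} *)
Definition A_eps (eps : 'I_n -> int) : pred A :=
  [pred a | eminus eps * a * eplus eps == 0].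

End AlgebraNotions.

(* 2-term complexes of projectives over a subalgebra Lambda (given by a     *)
(* predicate S on A containing the e_i).  Projectives are direct sums of    *)
(* the e_i Lambda; a map (+)_s e_{l s} Lambda -> (+)_r e_{l' r} Lambda is   *)
(* a matrix M with M r s in e_{l' r} Lambda e_{l s} acting by left mult.    *)
Record cplx (n : nat) (A : Type) := Cplx {
  c_nm1 : nat;                   (* number of summands of T^{-1} *)
  c_n0 : nat;                    (* number of summands of T^0 *)
  c_lm1 : 'I_c_nm1 -> 'I_n;      (* T^{-1} = (+)_s e_{c_lm1 s} Lambda *)
  c_l0 : 'I_c_n0 -> 'I_n;        (* T^0 = (+)_r e_{c_l0 r} Lambda *)
  c_d : 'M[A]_(c_n0, c_nm1) }.   (* differential T^{-1} -> T^0 *)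
Arguments c_nm1 {n A} c.
Arguments c_n0 {n A} c.
Arguments c_lm1 {n A} c _.
Arguments c_l0 {n A} c _.
Arguments c_d {n A} c.

Definition ord0_elim (n : nat) : 'I_0 -> 'I_n.
Proof. by case=> m; rewrite ltn0. Defined.

Definition lab_sum (n p q : nat) (l1 : 'I_p -> 'I_n) (l2 : 'I_q -> 'I_n)
  (k : 'I_(p + q)) : 'I_n :=
  match split k with inl a => l1 a | inr b => l2 b end.

Section Complexes.
Variables (F : fieldType) (A : falgType F) (n : nat) (e : 'I_n -> A)
          (S : pred A).

Definition pmap (p q : nat) (l' : 'I_q -> 'I_n) (l : 'I_p -> 'I_n)
  (M : 'M[A]_(q, p)) :=
  forall r s, M r s \in S /\ e (l' r) * M r s * e (l s) = M r s.

Definition valid_cplx (T : cplx n A) := pmap (c_l0 T) (c_lm1 T) (c_d T).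

Definition id_proj (p : nat) (l : 'I_p -> 'I_n) : 'M[A]_p :=
  \matrix_(r, s) (if r == s then e (l r) else 0).

Definition chain_map (T U : cplx n A) (f0 : 'M[A]_(c_n0 U, c_n0 T))
  (f1 : 'M[A]_(c_nm1 U, c_nm1 T)) :=
  pmap (c_l0 U) (c_l0 T) f0 /\ pmap (c_lm1 U) (c_lm1 T) f1 /\
  f0 *m c_d T = c_d U *m f1.

Definition null_homotopic (T U : cplx n A) (f0 : 'M[A]_(c_n0 U, c_n0 T))
  (f1 : 'M[A]_(c_nm1 U, c_nm1 T)) :=
  exists h : 'M[A]_(c_nm1 U, c_n0 T),
    pmap (c_lm1 U) (c_l0 T) h /\ f0 = c_d U *m h /\ f1 = h *m c_d T.

Definition isoK (T U : cplx n A) :=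
  exists f0 f1 g0 g1,
    @chain_map T U f0 f1 /\ @chain_map U T g0 g1 /\
    @null_homotopic T T (g0 *m f0 - id_proj (c_l0 T))
                        (g1 *m f1 - id_proj (c_lm1 T)) /\
    @null_homotopic U U (f0 *m g0 - id_proj (c_l0 U))
                        (f1 *m g1 - id_proj (c_lm1 U)).

Definition zeroK (T : cplx n A) :=
  @null_homotopic T T (id_proj (c_l0 T)) (id_proj (c_lm1 T)).

Definition zero_cplx : cplx n A :=
  @Cplx n A 0 0 (@ord0_elim n) (@ord0_elim n) 0.

Definition dsum (T U : cplx n A) : cplx n A :=
  @Cplx n A (c_nm1 T + c_nm1 U) (c_n0 T + c_n0 U)
    (lab_sum (c_lm1 T) (c_lm1 U)) (lab_sum (c_l0 T) (c_l0 U))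
    (block_mx (c_d T) 0 0 (c_d U)).

Definition dsum_seq (Ts : seq (cplx n A)) : cplx n A :=
  foldr dsum zero_cplx Ts.

Definition indecK (T : cplx n A) :=
  valid_cplx T /\ ~ zeroK T /\
  forall U V, valid_cplx U -> valid_cplx V -> isoK T (dsum U V) ->
    zeroK U \/ zeroK V.

(* Hom_K(T, U[l]) = 0 for l > 0; for 2-term complexes only l = 1 can be
   nonzero: a morphism T -> U[1] is any g : T^{-1} -> U^0, null-homotopic iff
   g = s0 d_T - d_U s1 with s0 : T^0 -> U^0, s1 : T^{-1} -> U^{-1}. *)
Definition hom_shift1_zero (T U : cplx n A) :=
  forall g : 'M[A]_(c_n0 U, c_nm1 T), pmap (c_l0 U) (c_lm1 T) g ->
    exists (s0 : 'M[A]_(c_n0 U, c_n0 T)) (s1 : 'M[A]_(c_nm1 U, c_nm1 T)),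
      pmap (c_l0 U) (c_l0 T) s0 /\ pmap (c_lm1 U) (c_lm1 T) s1 /\
      g = s0 *m c_d T - c_d U *m s1.

Definition presilting (T : cplx n A) := valid_cplx T /\ hom_shift1_zero T T.

Arguments chain_map : clear implicits.
Arguments null_homotopic : clear implicits.
Arguments hom_shift1_zero : clear implicits.
Variable R : realType.

(* K_0(proj Lambda)_R = R^n with basis [e_i Lambda] *)
Definition basisK0 (i : 'I_n) : 'rV[R]_n := delta_mx 0 i.

Definition classK0 (T : cplx n A) : 'rV[R]_n :=
  \sum_(r < c_n0 T) basisK0 (c_l0 T r) - \sum_(s < c_nm1 T) basisK0 (c_lm1 T s).

Definition cone (vs : seq 'rV[R]_n) : set 'rV[R]_n :=
  [set v | exists a : nat -> R, (forall i, 0 <= a i) /\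
           v = \sum_(i < size vs) a i *: vs`_i].

Definition Sigma : set (set 'rV[R]_n) :=
  [set sigma | exists Ts : seq (cplx n A),
     (forall i, (i < size Ts)%N -> indecK (nth zero_cplx Ts i)) /\
     (forall i j, (i < size Ts)%N -> (j < size Ts)%N -> i != j ->
        ~ isoK (nth zero_cplx Ts i) (nth zero_cplx Ts j)) /\
     presilting (dsum_seq Ts) /\
     sigma = cone (map classK0 Ts)].

Definition orthant (eps : 'I_n -> int) : set 'rV[R]_n :=
  cone [seq (eps i)%:~R *: basisK0 i | i <- enum 'I_n].

Definition Sigma_eps (eps : 'I_n -> int) : set (set 'rV[R]_n) :=
  [set sigma | Sigma sigma /\ sigma `<=` orthant eps].

End Complexes.

Definition fan_iso (R : realType) (n : nat) (M : 'M[int]_n)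
  (S1 S2 : set (set 'rV[R]_n)) :=
  let f := fun v : 'rV[R]_n => v *m map_mx (fun z : int => z%:~R) M in
  M \in unitmx /\
  (forall sigma, S1 sigma -> S2 (f @` sigma)) /\
  (forall tau, S2 tau -> exists! sigma, S1 sigma /\ tau = f @` sigma).

(* Main.v *)
Require Import Defs.
From HB Require Import structures.
From mathcomp Require Import all_boot all_order all_algebra all_field.
From mathcomp Require Import boolp classical_sets reals.
Import Order.TTheory GRing.Theory Num.Theory.
Local Open Scope ring_scope.

(** Over a subring [S] of [A] with [e_i S e_i = e_i A e_i], Gaussian elimination
    turns a two-term complex into a homotopy equivalent one of the same class
    whose differential lies in the radical. If such a complex is presilting,
    then no [e_i S] occurs in both degrees: the map [e_i S -> e_i S] from degree
    -1 to degree 0 would be [s0 d - d s1], which lies in the radical. Hence a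
    class in the orthant of [eps] forces degree 0 to be a sum of [e_i S] with
    [eps i = 1] and degree -1 a sum of [e_i S] with [eps i = -1].
    On such complexes the maps entering the presilting condition lie in
    [e+Ae-], [e+Ae+] and [e-Ae-], which are the same for [A] and [A_eps]. The
    two homotopy categories differ only in homotopies in [e-Ae+]; these change
    endomorphisms by radical ones, as [A] is basic, so they affect neither
    isomorphism nor indecomposability. *)

Set Implicit Arguments.
Unset Strict Implicit.
Unset Printing Implicit Defensive.

Local Notation pmap := Defs.pmap.

(** * Local corners and the radical *)

Section LocalCorner.
Variables (F : fieldType) (A : falgType F).
Implicit Types x y u : A.

(** The powers of [x] up to the dimension of [A] are one too many to be linearly independent, so
    some [x ^+ m] is a combination of later powers. Factoring out [x ^+ m.+1] leaves for [c] a
    polynomial in [x]. *)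
Lemma fitting_power x : exists m c, x ^+ m = x ^+ m.+1 * c /\ GRing.comm x c.
Proof.
pose X := [tuple x ^+ i | i < (\dim {:A}).+1].
have : ~~ free X.
  apply/negP => /eqP dX.
  by have := dimvS (subvf <<X>>%VS); rewrite dX size_tuple ltnn.
rewrite freeNE => /existsP[i]; rewrite -tnth_nth tnth_mktuple => xi.
have:= @coord_span _ _ _ (in_tuple (drop i.+1 X)) _ xi.
set a := coord _; move=> Ex; exists i.
exists (\sum_j a j (x ^+ i) *: x ^+ j); split.
  rewrite {1}Ex mulr_sumr; apply: eq_bigr => j _.
  rewrite -scalerAr -exprD /= nth_drop; congr (_ *: _).
  have lt_ij : (i.+1 + j < (\dim {:A}).+1)%N.
    by rewrite -ltn_subRL; apply: leq_trans (ltn_ord j) _; rewrite size_drop size_tuple.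
  have -> : (X`_(i.+1 + j) = tnth X (Ordinal lt_ij)) by rewrite (tnth_nth 0).
  by rewrite tnth_mktuple.
by apply: commr_sum => j _; rewrite /GRing.comm -scalerAl -scalerAr -exprS -exprSr.
Qed.

Variables (f : A) (prim_f : primitive_idem f).

Let ff : f * f = f. Proof. by case: prim_f. Qed.

Lemma cornerE x : f * x * f = x -> f * x = x /\ x * f = x.
Proof. by move=> <-; rewrite !mulrA ff -!mulrA ff. Qed.

(** Here [x] and [f - x] are orthogonal idempotents with sum [f]. *)
Lemma primitive_corner_idem x : f * x * f = x -> x * x = x -> x = 0 \/ x = f.
Proof.
move=> fx xx; have [fx1 xf1] := cornerE fx.
have [_ [_ prim]] := prim_f.
case: (prim x (f - x)) => //.
- by rewrite /Defs.idempotent mulrBl !mulrBr ff fx1 xf1 xx subrr subr0.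
- by rewrite mulrBr xf1 xx subrr.
- by rewrite mulrBl fx1 xx subrr.
- by rewrite addrC subrK.
- by left.
- by move/eqP; rewrite subr_eq0 => /eqP ->; right.
Qed.

Definition corner_unit x := exists2 y, f * y * f = y & y * x = f /\ x * y = f.

(** Fitting's lemma: [p] below is an idempotent of [f A f], hence [0] or [f]. In the first case [x]
    is nilpotent; in the second [x ^+ m * c ^+ m.+1], cut down to the corner, inverts [x]. *)
Lemma corner_unit_or_nil x : f * x * f = x ->
  corner_unit x \/ exists m, x ^+ m.+1 = 0.
Proof.
move=> fx; have [fx1 xf1] := cornerE fx.
have [[|m] [c [xm cxc]]] := fitting_power x.
  (* Exponent [0] means [x * c = 1]. It is set apart because [p] needs a positive power of [x] to
     lie in [f A f]. *)
  left; move: xm; rewrite expr0 expr1 => xc1; exists (f * c * f).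
    by rewrite !mulrA ff -!mulrA ff.
  split; first by rewrite -mulrA fx1 -mulrA -cxc -xc1 mulr1.
  by rewrite !mulrA xf1 -xc1 mul1r.
have cx k l : x ^+ k * c ^+ l = c ^+ l * x ^+ k.
  by apply: commrX; apply/commr_sym/commrX/commr_sym.
have xmk k : x ^+ m.+1 = x ^+ (k + m.+1) * c ^+ k.
  elim: k => [|k IH]; first by rewrite expr0 mulr1.
  rewrite {1}IH addSnnS !exprD (exprS c) -2!(mulrA (x ^+ k)).
  by rewrite (mulrA (x ^+ m.+2)) -xm.
pose p := x ^+ m.+1 * c ^+ m.+1.
have pp : p * p = p.
  rewrite /p mulrA -[x ^+ _ * _ * x ^+ _]mulrA -cx mulrA -exprD.
  by rewrite -(xmk m.+1).
have xp : x ^+ m.+1 * p = x ^+ m.+1 by rewrite mulrA -exprD -(xmk m.+1).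
have fp : f * p = p by rewrite /p exprS -!mulrA mulrA fx1.
have pf : p * f = p by rewrite /p cx (exprSr x) -(mulrA (c ^+ _)) -(mulrA (x ^+ m)) xf1.
have [p0|pE] : p = 0 \/ p = f by apply: primitive_corner_idem => //; rewrite fp pf.
  by right; exists m; rewrite -xp p0 mulr0.
left; exists (f * (x ^+ m * c ^+ m.+1) * f).
  by rewrite !mulrA ff -!mulrA ff.
split.
  have cx1 : c ^+ m.+1 * x = x * c ^+ m.+1 by have := cx 1%N m.+1; rewrite expr1.
  rewrite -(mulrA (f * _)) fx1 -(mulrA f) -(mulrA (x ^+ m)) cx1.
  by rewrite (mulrA (x ^+ m)) -exprSr -/p fp pE.
by rewrite !mulrA xf1 -exprS -/p pf pE.
Qed.

(** The inverse is the finite geometric series in [x]; flanking by [f] turns its term [x ^+ 0 = 1]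
    into [f]. *)
Lemma corner_unit_sub_nil x : f * x * f = x -> (exists m, x ^+ m.+1 = 0) ->
  corner_unit (f - x).
Proof.
move=> fx [m xm]; have [fx1 xf1] := cornerE fx.
exists (\sum_(i < m.+1) f * x ^+ i * f).
  rewrite mulr_sumr mulr_suml; apply: eq_bigr => i _.
  by rewrite !mulrA ff -!mulrA ff.
have tele : \sum_(i < m.+1) (f * x ^+ i * f - f * x ^+ i.+1 * f) = f.
  rewrite -(big_mkord xpredT (fun i => f * x ^+ i * f - f * x ^+ i.+1 * f)).
  rewrite -[LHS]opprK -sumrN; under eq_bigr do rewrite opprB.
  by rewrite telescope_sumr // xm mulr0 mul0r sub0r opprK expr0 mulr1.
split; rewrite -[RHS]tele.
  rewrite mulr_suml; apply: eq_bigr => i _.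
  by rewrite mulrBr -!mulrA ff fx1 exprSr -!mulrA xf1.
rewrite mulr_sumr; apply: eq_bigr => i _.
by rewrite mulrBl !mulrA ff xf1 exprS !mulrA fx1.
Qed.

(** This is the locality of [f A f]: if [x] is not a unit it is nilpotent, and then [y = f - x] is a
    unit. *)
Lemma corner_unit_add x y : f * x * f = x -> f * y * f = y -> x + y = f ->
  corner_unit x \/ corner_unit y.
Proof.
move=> fx fy xy; have [|xnil] := corner_unit_or_nil fx; first by left.
right; have -> : y = f - x by rewrite -xy addrAC subrr add0r.
exact: corner_unit_sub_nil.
Qed.
End LocalCorner.

(* [x y] is a nonzero idempotent of [g A g], so it is [g]. *)
Lemma primitive_linv_rinv (F : fieldType) (A : falgType F) (f g x y : A) :
  primitive_idem f -> primitive_idem g ->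
  g * x * f = x -> f * y * g = y -> y * x = f -> x * y = g.
Proof.
move=> pf pg gx fy yx.
have ff : f * f = f by case: pf.
have gg : g * g = g by case: pg.
have xf : x * f = x by rewrite -gx -mulrA ff.
have gx1 : g * x = x by rewrite -gx !mulrA gg.
have yg : y * g = y by rewrite -fy -mulrA gg.
have [] // := @primitive_corner_idem _ _ g pg (x * y).
- by rewrite mulrA gx1 -mulrA yg.
- by rewrite mulrA -[x * y * x]mulrA yx xf.
- move=> xy0; have [_ [f0 _]] := pf; case: f0.
  by rewrite -[f]ff -{1}yx -yx mulrA -[y * x * y]mulrA xy0 mulr0 mul0r.
Qed.

Section Radical.
Variables (F : fieldType) (A : falgType F) (n : nat) (e : 'I_n -> A).
Hypothesis orth_e : complete_orth_prim e.

Let e_sum : \sum_(i < n) e i = 1. Proof. by case: orth_e. Qed.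
Lemma prim_e i : primitive_idem (e i). Proof. by case: orth_e => _ [_]. Qed.
Lemma ee i : e i * e i = e i. Proof. by case: (prim_e i). Qed.
Lemma e_neq0 i : e i != 0. Proof. by apply/eqP; case: (prim_e i) => _ []. Qed.
Lemma ee0 i j : i != j -> e i * e j = 0. Proof. by case: orth_e => _ [+ _]; apply. Qed.

(* An idempotent-wise description of the Jacobson radical of [A]. *)
Definition jrad (x : A) := forall i y, e i * y * x * e i <> e i.

Lemma jrad_corner i x : jrad x -> ~ corner_unit (e i) (e i * x * e i).
Proof.
move=> Jx [y ey [yx _]]; apply: (Jx i (y * e i)); rewrite -[RHS]yx !mulrA.
by have [-> _] := cornerE (prim_e i) ey.
Qed.

(** A witness against [jrad] at [j] forces [j = i], since [x] lies in [e i A e i]. It is then a left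
    inverse in this corner, and by primitivity a two-sided one. *)
Lemma jradP i x : e i * x * e i = x -> ~ jrad x -> corner_unit (e i) x.
Proof.
move=> ex /existsNP[j] /existsNP[y] /contrapT Exy.
have [ij|ij] := eqVneq i j; last first.
  by case/eqP: (e_neq0 j); rewrite -Exy -ex -!mulrA ee0 // !mulr0.
subst j; have [ex1 xe1] := cornerE (prim_e i) ex.
have ye : e i * (e i * y * e i) * e i = e i * y * e i.
  by rewrite !mulrA ee -!mulrA ee.
have yx : e i * y * e i * x = e i by rewrite -mulrA ex1 -[x]xe1 mulrA.
exists (e i * y * e i) => //; split=> //.
exact: primitive_linv_rinv (prim_e i) (prim_e i) ex ye yx.
Qed.

Lemma jrad0 : jrad 0.
Proof. by move=> i y; rewrite mulr0 mul0r => /esym/eqP; rewrite (negPf (e_neq0 i)). Qed.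

Lemma jrad_e i : ~ jrad (e i).
Proof. by move/(_ i 1); rewrite mulr1 !ee. Qed.

Lemma jradMl x z : jrad x -> jrad (z * x).
Proof. by move=> Jx i y; rewrite mulrA -(mulrA (e i)); apply: Jx. Qed.

Lemma jradN x : jrad x -> jrad (- x).
Proof. by move=> Jx; rewrite -mulN1r; apply: jradMl. Qed.

Let corner_e i x : e i * (e i * x * e i) * e i = e i * x * e i.
Proof. by rewrite !mulrA ee -!mulrA ee. Qed.

(** If [e i * y * (x + z) * e i = e i], locality makes one of the two summands a unit of the
    corner. *)
Lemma jradD x z : jrad x -> jrad z -> jrad (x + z).
Proof.
move=> Jx Jz i y; rewrite mulrDr mulrDl -!(mulrA (e i) y).
by case/(corner_unit_add (prim_e i) (corner_e i _) (corner_e i _));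
  apply: jrad_corner; apply: jradMl.
Qed.

Lemma jradB x z : jrad x -> jrad z -> jrad (x - z).
Proof. by move=> Jx Jz; apply: jradD => //; apply: jradN. Qed.

Lemma jrad_sum (I : Type) (r : seq I) (P : pred I) (G : I -> A) :
  (forall i, P i -> jrad (G i)) -> jrad (\sum_(i <- r | P i) G i).
Proof. by move=> JG; elim/big_ind: _ => //; [apply: jrad0|apply: jradD]. Qed.

(** The definition of [jrad] absorbs left factors only. Expanding [1] on both sides of [z] reduces
    to factors [e j * z * e i]; a product equal to [e i] with such a last factor gives, in the
    reverse order, a product equal to [e j], contradicting [jrad x] at [j]. *)
Lemma jradMr x z : jrad x -> jrad (x * z).
Proof.
move=> Jx; rewrite -[x * z]mulr1 -e_sum mulr_sumr; apply: jrad_sum => i _.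
rewrite -[x]mulr1 -e_sum mulr_sumr !mulr_suml; apply: jrad_sum => j _ k y.
have [<-|ik] := eqVneq i k; last first.
  by rewrite -!mulrA ee0 // !mulr0 => /esym/eqP; rewrite (negPf (e_neq0 k)).
rewrite -!mulrA ee => Exz.
have cd : e i * y * x * e j * (e j * z * e i) = e i.
  by rewrite -!mulrA [e j * (e j * _)]mulrA ee.
have dc := primitive_linv_rinv (prim_e i) (prim_e j) _ _ cd.
apply: (Jx j (z * e i * y)); rewrite -[RHS]dc.
- by rewrite -!mulrA [e i * (e i * _)]mulrA ee.
- by rewrite !mulrA ee -!mulrA ee.
- by rewrite !mulrA ee -!mulrA ee.
Qed.

(** A radical element of a corner is not a unit, so it is nilpotent, and the geometric series
    applies. *)
Lemma jrad_unit i x : jrad x -> corner_unit (e i) (e i + e i * x * e i).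
Proof.
move=> Jx; have ex := corner_e i x.
have [/(jrad_corner Jx)//|[m xm]] := corner_unit_or_nil (prim_e i) ex.
rewrite -[X in _ + X]opprK; apply: (corner_unit_sub_nil (prim_e i)).
  by rewrite mulrN mulNr ex.
by exists m; rewrite exprNn xm mulr0.
Qed.

Hypothesis basic_e : basic_alg e.

(** Otherwise left multiplication by [e j * x * e i] would be an isomorphism from [e i A] to
    [e j A], which [basic_e] excludes. *)
Lemma jrad_offdiag i j x : i != j -> jrad (e j * x * e i).
Proof.
move=> ij k y; have [<-|ik] := eqVneq i k; last first.
  by rewrite -!mulrA ee0 // !mulr0 => /esym/eqP; rewrite (negPf (e_neq0 k)).
move=> Eyx; case/eqP: ij; apply: basic_e.
have ex : e j * (e j * x * e i) * e i = e j * x * e i.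
  by rewrite !mulrA ee -!mulrA ee.
have ey : e i * (e i * y * e j) * e j = e i * y * e j.
  by rewrite !mulrA ee -!mulrA ee.
have yx : e i * y * e j * (e j * x * e i) = e i.
  by rewrite -[RHS]Eyx -!mulrA ee [e j * (e j * _)]mulrA ee.
exists (e j * x * e i), (e i * y * e j); do 3!split=> //.
exact: primitive_linv_rinv (prim_e i) (prim_e j) ex ey yx.
Qed.
End Radical.

(** * The homotopy category of two-term complexes *)

Section LabSum.
Variables (n p q : nat) (l1 : 'I_p -> 'I_n) (l2 : 'I_q -> 'I_n).

Lemma lab_sum_lshift i : lab_sum l1 l2 (lshift q i) = l1 i.
Proof. by rewrite /lab_sum (unsplitK (inl i)). Qed.

Lemma lab_sum_rshift i : lab_sum l1 l2 (rshift p i) = l2 i.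
Proof. by rewrite /lab_sum (unsplitK (inr i)). Qed.

Lemma id_proj_lab_sum (F : fieldType) (A : falgType F) (e : 'I_n -> A) :
  id_proj e (lab_sum l1 l2) = block_mx (id_proj e l1) 0 0 (id_proj e l2).
Proof.
apply/matrixP => r s; rewrite mxE.
case: (split_ordP r) => {}r ->; case: (split_ordP s) => {}s ->;
rewrite ?(block_mxEul, block_mxEur, block_mxEdl, block_mxEdr) !mxE
  ?lab_sum_lshift ?lab_sum_rshift ?eq_lshift ?eq_rshift ?eq_lrshift ?eq_rlshift //.
Qed.
End LabSum.

(* Both [A] and [A_eps] qualify. *)
Record corner_subring (F : fieldType) (A : falgType F) n (e : 'I_n -> A)
    (S : pred A) : Prop := CornerSubring {
  csub0 : 0 \in S;
  csubB : forall x y, x \in S -> y \in S -> x - y \in S;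
  csubM : forall x y, x \in S -> y \in S -> x * y \in S;
  csub_corner : forall i x, e i * x * e i \in S }.

Section HomotopyCategory.
Variables (F : fieldType) (A : falgType F) (n : nat) (e : 'I_n -> A).
Hypothesis orth_e : complete_orth_prim e.
Variables (S : pred A).
Hypothesis subS : corner_subring e S.
Implicit Types T U V W : cplx n A.

Let eeE := ee orth_e.

Lemma csubN x : x \in S -> - x \in S.
Proof. by move=> Sx; rewrite -sub0r; apply: (csubB subS) => //; apply: csub0 subS. Qed.

Lemma csubD x y : x \in S -> y \in S -> x + y \in S.
Proof. by move=> Sx Sy; rewrite -[y]opprK; apply: (csubB subS) => //; apply: csubN. Qed.

Lemma csub_e i : e i \in S.
Proof. by have := csub_corner subS i (e i); rewrite !eeE. Qed.

Section Pmap.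
Variables (p q : nat) (l' : 'I_q -> 'I_n) (l : 'I_p -> 'I_n).
Implicit Types M N : 'M[A]_(q, p).

Lemma pmap0 : pmap e S l' l 0.
Proof. by move=> r s; rewrite mxE mulr0 mul0r (csub0 subS). Qed.

Lemma pmapN M : pmap e S l' l M -> pmap e S l' l (- M).
Proof.
by move=> HM r s; have [SM EM] := HM r s; rewrite mxE csubN // mulrN mulNr EM.
Qed.

Lemma pmapD M N : pmap e S l' l M -> pmap e S l' l N -> pmap e S l' l (M + N).
Proof.
move=> HM HN r s; have [SM EM] := HM r s; have [SN EN] := HN r s.
by rewrite mxE csubD // mulrDr mulrDl EM EN.
Qed.

Lemma pmapB M N : pmap e S l' l M -> pmap e S l' l N -> pmap e S l' l (M - N).
Proof. by move=> HM HN; apply: pmapD => //; apply: pmapN. Qed.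

Lemma pmap_idl M : pmap e S l' l M -> id_proj e l' *m M = M.
Proof.
move=> HM; apply/matrixP => r s; rewrite mxE (bigD1 r) //= big1 ?addr0.
  by rewrite mxE eqxx; have [_ <-] := HM r s; rewrite !mulrA eeE.
by move=> k kr; rewrite mxE eq_sym (negPf kr) mul0r.
Qed.

Lemma pmap_idr M : pmap e S l' l M -> M *m id_proj e l = M.
Proof.
move=> HM; apply/matrixP => r s; rewrite mxE (bigD1 s) //= big1 ?addr0.
  by rewrite mxE eqxx; have [_ <-] := HM r s; rewrite -!mulrA eeE.
by move=> k kr; rewrite mxE (negPf kr) mulr0.
Qed.
End Pmap.

Lemma pmapM p q r (l1 : 'I_p -> 'I_n) (l2 : 'I_q -> 'I_n) (l3 : 'I_r -> 'I_n)
    (M : 'M[A]_(r, q)) (N : 'M[A]_(q, p)) :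
  pmap e S l3 l2 M -> pmap e S l2 l1 N -> pmap e S l3 l1 (M *m N).
Proof.
move=> HM HN i j; rewrite mxE; split.
  elim/big_ind: _ => [|x y|k _]; [exact: csub0 subS|exact: csubD|].
  by have [? _] := HM i k; have [? _] := HN k j; apply: (csubM subS).
rewrite mulr_sumr mulr_suml; apply: eq_bigr => k _.
have [_ <-] := HM i k; have [_ <-] := HN k j.
by rewrite !mulrA eeE -!mulrA eeE.
Qed.

Lemma pmap_id p (l : 'I_p -> 'I_n) : pmap e S l l (id_proj e l).
Proof.
move=> r s; rewrite mxE; have [<-|_] := eqVneq r s; last first.
  by rewrite mulr0 mul0r (csub0 subS).
by rewrite csub_e !eeE.
Qed.

Lemma pmap_col p q1 q2 (l1 : 'I_q1 -> 'I_n) (l2 : 'I_q2 -> 'I_n) (l : 'I_p -> 'I_n)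
    (M : 'M[A]_(q1, p)) (N : 'M[A]_(q2, p)) :
  pmap e S (lab_sum l1 l2) l (col_mx M N) <-> pmap e S l1 l M /\ pmap e S l2 l N.
Proof.
split=> [HMN|[HM HN] r s].
  split=> r s.
    by have := HMN (lshift _ r) s; rewrite col_mxEu lab_sum_lshift.
  by have := HMN (rshift _ r) s; rewrite col_mxEd lab_sum_rshift.
case: (split_ordP r) => {}r ->.
  by rewrite col_mxEu lab_sum_lshift.
by rewrite col_mxEd lab_sum_rshift.
Qed.

Lemma pmap_row p1 p2 q (l1 : 'I_p1 -> 'I_n) (l2 : 'I_p2 -> 'I_n) (l : 'I_q -> 'I_n)
    (M : 'M[A]_(q, p1)) (N : 'M[A]_(q, p2)) :
  pmap e S l (lab_sum l1 l2) (row_mx M N) <-> pmap e S l l1 M /\ pmap e S l l2 N.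
Proof.
split=> [HMN|[HM HN] r s].
  split=> r s.
    by have := HMN r (lshift _ s); rewrite row_mxEl lab_sum_lshift.
  by have := HMN r (rshift _ s); rewrite row_mxEr lab_sum_rshift.
case: (split_ordP s) => {}s ->.
  by rewrite row_mxEl lab_sum_lshift.
by rewrite row_mxEr lab_sum_rshift.
Qed.

Lemma chain_id T : valid_cplx e S T ->
  chain_map e S (id_proj e (c_l0 T)) (id_proj e (c_lm1 T)).
Proof.
by move=> vT; do 2!(split; first exact: pmap_id); rewrite (pmap_idl vT) (pmap_idr vT).
Qed.

Lemma chain_comp T U V f0 f1 g0 g1 :
  @chain_map _ _ _ e S T U f0 f1 -> @chain_map _ _ _ e S U V g0 g1 ->
  @chain_map _ _ _ e S T V (g0 *m f0) (g1 *m f1).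
Proof.
move=> [f0P [f1P fE]] [g0P [g1P gE]].
by split; [exact: pmapM f0P|split; [exact: pmapM f1P|rewrite -mulmxA fE !mulmxA gE]].
Qed.

Lemma null_comp T U V W f0 f1 a0 a1 g0 g1 :
  @chain_map _ _ _ e S T U f0 f1 -> @null_homotopic _ _ _ e S U V a0 a1 ->
  @chain_map _ _ _ e S V W g0 g1 ->
  @null_homotopic _ _ _ e S T W (g0 *m a0 *m f0) (g1 *m a1 *m f1).
Proof.
move=> [f0P [f1P fE]] [h [hP [-> ->]]] [g0P [g1P gE]].
exists (g1 *m h *m f0); split; first exact: pmapM (pmapM g1P hP) f0P.
by rewrite -!mulmxA -fE !mulmxA gE.
Qed.

Lemma null_add T U a0 a1 b0 b1 :
  @null_homotopic _ _ _ e S T U a0 a1 -> @null_homotopic _ _ _ e S T U b0 b1 ->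
  @null_homotopic _ _ _ e S T U (a0 + b0) (a1 + b1).
Proof.
move=> [h [hP [-> ->]]] [k [kP [-> ->]]]; exists (h + k).
by rewrite mulmxDr mulmxDl; split; first exact: pmapD.
Qed.

Lemma null0 T U : @null_homotopic _ _ _ e S T U 0 0.
Proof. by exists 0; rewrite mulmx0 mul0mx; split; first exact: pmap0. Qed.

(** From [g h f - 1 = g (h - 1) f + (g f - 1)]. This is what makes isomorphisms and retractions in
    the homotopy category compose. *)
Lemma null_comp_sub_id T U f0 f1 g0 g1 (h0 : 'M_(c_n0 U)) (h1 : 'M_(c_nm1 U)) :
  @chain_map _ _ _ e S T U f0 f1 -> @chain_map _ _ _ e S U T g0 g1 ->
  @null_homotopic _ _ _ e S U U (h0 - id_proj e (c_l0 U)) (h1 - id_proj e (c_lm1 U)) ->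
  @null_homotopic _ _ _ e S T T (g0 *m f0 - id_proj e (c_l0 T))
    (g1 *m f1 - id_proj e (c_lm1 T)) ->
  @null_homotopic _ _ _ e S T T (g0 *m h0 *m f0 - id_proj e (c_l0 T))
    (g1 *m h1 *m f1 - id_proj e (c_lm1 T)).
Proof.
move=> fP gP hN gfN; have := null_add (null_comp fP hN gP) gfN.
have [g0P [g1P _]] := gP; rewrite !mulmxBr !mulmxBl (pmap_idr g0P) (pmap_idr g1P).
by rewrite !addrA !subrK.
Qed.

(* [U] is a direct summand of [T] in the homotopy category *)
Definition retractK T U := exists f0 f1 g0 g1,
  [/\ @chain_map _ _ _ e S T U f0 f1, @chain_map _ _ _ e S U T g0 g1 &
      @null_homotopic _ _ _ e S U U (f0 *m g0 - id_proj e (c_l0 U))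
        (f1 *m g1 - id_proj e (c_lm1 U))].

Lemma isoK_sym T U : isoK e S T U -> isoK e S U T.
Proof. by move=> [f0 [f1 [g0 [g1 [? [? []]]]]]]; exists g0, g1, f0, f1. Qed.

Lemma isoK_retract T U : isoK e S T U -> retractK T U.
Proof. by move=> [f0 [f1 [g0 [g1 [? [? []]]]]]]; exists f0, f1, g0, g1. Qed.

Lemma isoK_trans T U V : isoK e S T U -> isoK e S U V -> isoK e S T V.
Proof.
move=> [f0 [f1 [g0 [g1 [fP [gP [gfN fgN]]]]]]].
move=> [f0' [f1' [g0' [g1' [f'P [g'P [gfN' fgN']]]]]]].
exists (f0' *m f0), (f1' *m f1), (g0 *m g0'), (g1 *m g1').
split; first exact: chain_comp f'P.
split; first exact: chain_comp gP.
split.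
  by have := null_comp_sub_id fP gP gfN' gfN; rewrite !mulmxA.
by have := null_comp_sub_id g'P f'P fgN fgN'; rewrite !mulmxA.
Qed.

Lemma retractK_trans T U V : retractK T U -> retractK U V -> retractK T V.
Proof.
move=> [f0 [f1 [g0 [g1 [fP gP fgN]]]]].
move=> [f0' [f1' [g0' [g1' [f'P g'P fgN']]]]].
exists (f0' *m f0), (f1' *m f1), (g0 *m g0'), (g1 *m g1').
split; [exact: chain_comp f'P|exact: chain_comp gP|].
by have := null_comp_sub_id g'P f'P fgN fgN'; rewrite !mulmxA.
Qed.

(** The identity of [U] is [f id_T g] minus the null-homotopic [f g - id_U]. *)
Lemma zeroK_retract T U : retractK T U -> zeroK e S T -> zeroK e S U.
Proof.
move=> [f0 [f1 [g0 [g1 [fP gP [h [hP [h0 h1]]]]]]]] zT.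
have [f0P [f1P _]] := fP.
have hN : @null_homotopic _ _ _ e S U U (c_d U *m - h) (- h *m c_d U).
  by exists (- h); split; first exact: pmapN.
have := null_add (null_comp gP zT fP) hN.
rewrite (pmap_idr f0P) (pmap_idr f1P) mulmxN mulNmx -h0 -h1 !opprB.
by rewrite !(addrC (_ *m _)) !subrK.
Qed.

(** A null-homotopy of [g f1], composed with the map back to [T], is one of [g f1 g1], which differs
    from [g] by [g h d]. The next lemma is the same argument in the second variable. *)
Lemma hom_shift1_retractl T T' U : retractK T T' ->
  hom_shift1_zero e S T U -> hom_shift1_zero e S T' U.
Proof.
move=> [f0 [f1 [g0 [g1 [[f0P [f1P fE]] [g0P [g1P gE]] [h [hP [h0 h1]]]]]]]].
move=> homT g gP.
have [s0 [s1 [s0P [s1P gf]]]] := homT (g *m f1) (pmapM gP f1P).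
exists (s0 *m g0 - g *m h), (s1 *m g1); split; [|split].
- by apply: pmapB; [exact: pmapM s0P g0P|exact: pmapM gP hP].
- exact: pmapM s1P g1P.
rewrite mulmxBl -(mulmxA g h) -h1 -(mulmxA s0) gE !mulmxA.
rewrite mulmxBr (pmap_idr gP) (mulmxA g) gf mulmxBl !opprB.
by rewrite addrCA [X in _ + X - _]addrC subrK addrK.
Qed.

Lemma hom_shift1_retractr T U U' : retractK U U' ->
  hom_shift1_zero e S T U -> hom_shift1_zero e S T U'.
Proof.
move=> [f0 [f1 [g0 [g1 [[f0P [f1P fE]] [g0P [g1P gE]] [h [hP [h0 h1]]]]]]]].
move=> homT g gP.
have [s0 [s1 [s0P [s1P gf]]]] := homT (g0 *m g) (pmapM g0P gP).
exists (f0 *m s0), (f1 *m s1 + h *m g); split; [|split].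
- exact: pmapM f0P s0P.
- by apply: pmapD; [exact: pmapM f1P s1P|exact: pmapM hP gP].
rewrite mulmxDr !mulmxA -h0 -fE mulmxBl (pmap_idl gP) -(mulmxA f0 g0) gf.
by rewrite mulmxBr !mulmxA addrA [X in - (X - _)]addrC subrK opprB addrC subrK.
Qed.

(** * Direct sums and the presilting condition on summands *)

Lemma valid_dsum T U : valid_cplx e S (dsum T U) <->
  valid_cplx e S T /\ valid_cplx e S U.
Proof.
rewrite /valid_cplx /= /block_mx; split.
  by move=> /pmap_col[/pmap_row[? _] /pmap_row[_ ?]].
by move=> [? ?]; apply/pmap_col; split; apply/pmap_row; split=> //; apply: pmap0.
Qed.

Lemma chain_dsum T U T' U' f0 f1 g0 g1 :
  @chain_map _ _ _ e S T T' f0 f1 -> @chain_map _ _ _ e S U U' g0 g1 ->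
  @chain_map _ _ _ e S (dsum T U) (dsum T' U') (block_mx f0 0 0 g0) (block_mx f1 0 0 g1).
Proof.
move=> [f0P [f1P fE]] [g0P [g1P gE]]; split; [|split].
- by apply/pmap_col; split; apply/pmap_row; split=> //; apply: pmap0.
- by apply/pmap_col; split; apply/pmap_row; split=> //; apply: pmap0.
- by rewrite /= !mulmx_block !(mul0mx, mulmx0, addr0, add0r) fE gE.
Qed.

Lemma null_dsum T U T' U' f0 f1 g0 g1 :
  @null_homotopic _ _ _ e S T T' f0 f1 -> @null_homotopic _ _ _ e S U U' g0 g1 ->
  @null_homotopic _ _ _ e S (dsum T U) (dsum T' U') (block_mx f0 0 0 g0)
    (block_mx f1 0 0 g1).
Proof.
move=> [h [hP [-> ->]]] [k [kP [-> ->]]]; exists (block_mx h 0 0 k); split.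
  by apply/pmap_col; split; apply/pmap_row; split=> //; apply: pmap0.
by rewrite /= !mulmx_block !(mul0mx, mulmx0, addr0, add0r).
Qed.

Lemma isoK_dsum T U T' U' : isoK e S T T' -> isoK e S U U' ->
  isoK e S (dsum T U) (dsum T' U').
Proof.
move=> [f0 [f1 [g0 [g1 [fP [gP [gfN fgN]]]]]]].
move=> [f0' [f1' [g0' [g1' [f'P [g'P [gfN' fgN']]]]]]].
exists (block_mx f0 0 0 f0'), (block_mx f1 0 0 f1').
exists (block_mx g0 0 0 g0'), (block_mx g1 0 0 g1').
split; first exact: chain_dsum.
split; first exact: chain_dsum.
split; rewrite !id_proj_lab_sum !mulmx_block !(mul0mx, mulmx0, addr0, add0r);
  rewrite !opp_block_mx !add_block_mx !subr0; exact: null_dsum.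
Qed.

Lemma retractK_dsuml T U : valid_cplx e S T -> retractK (dsum T U) T.
Proof.
move=> vT; pose E0 := id_proj e (c_l0 T); pose E1 := id_proj e (c_lm1 T).
exists (row_mx E0 0), (row_mx E1 0), (col_mx E0 0), (col_mx E1 0); split.
- split; [|split].
  + by apply/pmap_row; split; [exact: pmap_id|exact: pmap0].
  + by apply/pmap_row; split; [exact: pmap_id|exact: pmap0].
  + rewrite /= mul_row_block mul_mx_row (pmap_idl vT) (pmap_idr vT).
    by rewrite !(mul0mx, mulmx0) !addr0.
- split; [|split].
  + by apply/pmap_col; split; [exact: pmap_id|exact: pmap0].
  + by apply/pmap_col; split; [exact: pmap_id|exact: pmap0].
  + rewrite /= mul_block_col mul_col_mx (pmap_idl vT) (pmap_idr vT).
    by rewrite !(mul0mx, mulmx0) !addr0.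
- rewrite !mul_row_col !mul0mx !addr0.
  rewrite (pmap_idl (pmap_id (c_l0 T))) (pmap_idl (pmap_id (c_lm1 T))) !subrr.
  exact: null0.
Qed.

Lemma retractK_dsumr T U : valid_cplx e S U -> retractK (dsum T U) U.
Proof.
move=> vT; pose E0 := id_proj e (c_l0 U); pose E1 := id_proj e (c_lm1 U).
exists (row_mx 0 E0), (row_mx 0 E1), (col_mx 0 E0), (col_mx 0 E1); split.
- split; [|split].
  + by apply/pmap_row; split; [exact: pmap0|exact: pmap_id].
  + by apply/pmap_row; split; [exact: pmap0|exact: pmap_id].
  + rewrite /= mul_row_block mul_mx_row (pmap_idl vT) (pmap_idr vT).
    by rewrite !(mul0mx, mulmx0) !add0r.
- split; [|split].
  + by apply/pmap_col; split; [exact: pmap0|exact: pmap_id].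
  + by apply/pmap_col; split; [exact: pmap0|exact: pmap_id].
  + rewrite /= mul_block_col mul_col_mx (pmap_idl vT) (pmap_idr vT).
    by rewrite !(mul0mx, mulmx0) !add0r.
- rewrite !mul_row_col !mul0mx !add0r.
  rewrite (pmap_idl (pmap_id (c_l0 U))) (pmap_idl (pmap_id (c_lm1 U))) !subrr.
  exact: null0.
Qed.

Lemma hom_shift1_dsuml T U V : valid_cplx e S T -> valid_cplx e S U ->
  hom_shift1_zero e S (dsum T U) V <->
  hom_shift1_zero e S T V /\ hom_shift1_zero e S U V.
Proof.
move=> vT vU; split=> [homTU|[homT homU] g].
  split; apply: hom_shift1_retractl homTU => //.
    exact: retractK_dsuml.
  exact: retractK_dsumr.
rewrite -[g]hsubmxK => /pmap_row[/homT[s0 [s1 [s0P [s1P ->]]]]].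
move=> /homU[t0 [t1 [t0P [t1P ->]]]].
exists (row_mx s0 t0), (row_mx s1 t1); split; first exact/pmap_row.
split; first exact/pmap_row.
rewrite /= mul_row_block mul_mx_row !mulmx0 addr0 add0r.
by rewrite opp_row_mx add_row_mx.
Qed.

Lemma hom_shift1_dsumr T U V : valid_cplx e S T -> valid_cplx e S U ->
  hom_shift1_zero e S V (dsum T U) <->
  hom_shift1_zero e S V T /\ hom_shift1_zero e S V U.
Proof.
move=> vT vU; split=> [homTU|[homT homU] g].
  split; apply: hom_shift1_retractr homTU => //.
    exact: retractK_dsuml.
  exact: retractK_dsumr.
rewrite -[g]vsubmxK => /pmap_col[/homT[s0 [s1 [s0P [s1P ->]]]]].
move=> /homU[t0 [t1 [t0P [t1P ->]]]].
exists (col_mx s0 t0), (col_mx s1 t1); split; first exact/pmap_col.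
split; first exact/pmap_col.
rewrite /= mul_block_col mul_col_mx !mul0mx addr0 add0r.
by rewrite opp_col_mx add_col_mx.
Qed.

Local Notation "Ts `[ i ]" := (nth (zero_cplx A n) Ts i) (at level 2, format "Ts `[ i ]").

Lemma valid_dsum_seq Ts : valid_cplx e S (dsum_seq Ts) <->
  forall i, (i < size Ts)%N -> valid_cplx e S Ts`[i].
Proof.
elim: Ts => [|T Ts IH]; first by split=> // _ [].
rewrite [dsum_seq _]/= valid_dsum IH; split=> [[vT vTs] [|i] //|vTs].
  exact: vTs.
by split=> [|i]; [apply: (vTs 0)|apply: (vTs i.+1)].
Qed.

Lemma hom_shift1_dsum_seql Ts V : valid_cplx e S (dsum_seq Ts) ->
  hom_shift1_zero e S (dsum_seq Ts) V <->
  forall i, (i < size Ts)%N -> hom_shift1_zero e S Ts`[i] V.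
Proof.
elim: Ts => [_|T Ts IH].
  split=> // _ g _; exists 0, 0; split; first exact: pmap0.
  by split; [exact: pmap0|apply/matrixP => r []].
rewrite [dsum_seq _]/= => /valid_dsum[vT vTs]; rewrite hom_shift1_dsuml // IH //.
split=> [[hT hTs] [|i] //|hTs]; first exact: hTs.
by split=> [|i]; [apply: (hTs 0)|apply: (hTs i.+1)].
Qed.

Lemma hom_shift1_dsum_seqr Ts V : valid_cplx e S (dsum_seq Ts) ->
  hom_shift1_zero e S V (dsum_seq Ts) <->
  forall i, (i < size Ts)%N -> hom_shift1_zero e S V Ts`[i].
Proof.
elim: Ts => [_|T Ts IH].
  split=> // _ g _; exists 0, 0; split; first exact: pmap0.
  by split; [exact: pmap0|apply/matrixP => -[]].
rewrite [dsum_seq _]/= => /valid_dsum[vT vTs]; rewrite hom_shift1_dsumr // IH //.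
split=> [[hT hTs] [|i] //|hTs]; first exact: hTs.
by split=> [|i]; [apply: (hTs 0)|apply: (hTs i.+1)].
Qed.

(** The pairwise form allows the summands to be replaced one at a time by homotopy equivalent
    complexes. *)
Lemma presilting_dsum_seq Ts : presilting e S (dsum_seq Ts) <->
  (forall i, (i < size Ts)%N -> valid_cplx e S Ts`[i]) /\
  (forall i j, (i < size Ts)%N -> (j < size Ts)%N ->
     hom_shift1_zero e S Ts`[i] Ts`[j]).
Proof.
split=> [[vTs]|[/valid_dsum_seq vTs homTs]].
  rewrite hom_shift1_dsum_seql // => homTs; split; first exact/valid_dsum_seq.
  by move=> i j iTs jTs; have /hom_shift1_dsum_seqr := homTs i iTs; apply.
split=> //; apply/hom_shift1_dsum_seql => // i iTs.
by apply/hom_shift1_dsum_seqr => // j jTs; apply: homTs.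
Qed.

Lemma isoK_refl T : valid_cplx e S T -> isoK e S T T.
Proof.
move=> vT; have idP := chain_id vT.
exists (id_proj e (c_l0 T)), (id_proj e (c_lm1 T)).
exists (id_proj e (c_l0 T)), (id_proj e (c_lm1 T)).
rewrite (pmap_idl (pmap_id (c_l0 T))) (pmap_idl (pmap_id (c_lm1 T))) !subrr.
by do 2!(split=> //); split; exact: null0.
Qed.

(** * Gaussian elimination *)

(** The Schur complement of the entry at [(r0, s0)]; [u] stands for the inverse of this pivot in its
    corner ring, and [lift] skips the pivot row and column. *)
Definition gauss_reduce T (r0 : 'I_(c_n0 T)) (s0 : 'I_(c_nm1 T)) (u : A) : cplx n A :=
  Cplx (fun s => c_lm1 T (lift s0 s)) (fun r => c_l0 T (lift r0 r))
    (\matrix_(r, s) (c_d T (lift r0 r) (lift s0 s) -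
                     c_d T (lift r0 r) s0 * (u * c_d T r0 (lift s0 s)))).

(** [P] and [Q] are the projection to and the inclusion of the summands other than [r0]; thus [P Q]
    is the identity, and [Q P] is the identity minus the idempotent of summand [r0]. [sng] is a
    matrix with a single entry. *)
Let P p (l : 'I_p -> 'I_n) (r0 : 'I_p) : 'M[A]_(p.-1, p) :=
  \matrix_(r, s) id_proj e l (lift r0 r) s.
Let Q p (l : 'I_p -> 'I_n) (r0 : 'I_p) : 'M[A]_(p, p.-1) :=
  \matrix_(r, s) id_proj e l r (lift r0 s).
Let sng p q (a : 'I_p) (b : 'I_q) (x : A) : 'M[A]_(p, q) :=
  \matrix_(i, j) (if (i == a) && (j == b) then x else 0).

Let id_id p (l : 'I_p -> 'I_n) : id_proj e l *m id_proj e l = id_proj e l.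
Proof. exact: pmap_idl (pmap_id l). Qed.

Let sng_mull p q m (a : 'I_p) (b : 'I_q) x (M : 'M[A]_(q, m)) i j :
  (sng a b x *m M) i j = if i == a then x * M b j else 0.
Proof.
rewrite mxE (bigD1 b) //= big1 ?addr0 => [|k kb].
  by rewrite mxE eqxx andbT; case: eqP => // _; rewrite mul0r.
by rewrite mxE (negPf kb) andbF mul0r.
Qed.

Let sng_mulr p q m (a : 'I_p) (b : 'I_q) x (M : 'M[A]_(m, p)) i j :
  (M *m sng a b x) i j = if j == b then M i a * x else 0.
Proof.
rewrite mxE (bigD1 a) //= big1 ?addr0 => [|k kb].
  by rewrite mxE eqxx /=; case: eqP => // _; rewrite mulr0.
by rewrite mxE (negPf kb) mulr0.
Qed.

Let sng_sng p q m k (a : 'I_p) (b : 'I_q) x (M : 'M[A]_(q, m)) (c : 'I_m) (d : 'I_k) y :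
  sng a b x *m M *m sng c d y = sng a d (x * M b c * y).
Proof.
apply/matrixP => i j; rewrite sng_mulr sng_mull mxE.
by case: (i == a); case: (j == d) => //=; rewrite mul0r.
Qed.

Let PQ p (l : 'I_p -> 'I_n) r0 : P l r0 *m Q l r0 = id_proj e (fun r => l (lift r0 r)).
Proof.
apply/matrixP => r s; rewrite mxE.
transitivity ((id_proj e l *m id_proj e l) (lift r0 r) (lift r0 s)).
  by rewrite mxE; apply: eq_bigr => k _; rewrite [P _ _ _ _]mxE [Q _ _ _ _]mxE.
by rewrite id_id !mxE (inj_eq lift_inj).
Qed.

Let QP p (l : 'I_p -> 'I_n) r0 : Q l r0 *m P l r0 = id_proj e l - sng r0 r0 (e (l r0)).
Proof.
rewrite -[X in X - _]id_id; apply/matrixP => r s.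
rewrite [RHS]mxE [(_ *m id_proj e l) _ _]mxE (bigD1_ord r0) //= addrC.
have -> : id_proj e l r r0 * id_proj e l r0 s = sng r0 r0 (e (l r0)) r s.
  rewrite !mxE; have [->|_] := eqVneq r r0; last by rewrite mul0r.
  by rewrite eq_sym; case: eqP => _; rewrite ?eeE ?mulr0.
rewrite [X in X + _]mxE addKr mxE; apply: eq_bigr => k _.
by rewrite [P _ _ _ _]mxE [Q _ _ _ _]mxE.
Qed.

Let pmapP p (l : 'I_p -> 'I_n) r0 : pmap e S (fun r => l (lift r0 r)) l (P l r0).
Proof. by move=> r s; have := pmap_id l (lift r0 r) s; rewrite [P _ _ _ _]mxE. Qed.

Let pmapQ p (l : 'I_p -> 'I_n) r0 : pmap e S l (fun r => l (lift r0 r)) (Q l r0).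
Proof. by move=> r s; have := pmap_id l r (lift r0 s); rewrite [Q _ _ _ _]mxE. Qed.

Section Reduction.
Variables (T : cplx n A) (r0 : 'I_(c_n0 T)) (s0 : 'I_(c_nm1 T)) (u : A).
Hypothesis vT : valid_cplx e S T.
Hypothesis lab_eq : c_lm1 T s0 = c_l0 T r0.
Hypothesis uE : e (c_l0 T r0) * u * e (c_l0 T r0) = u.
Hypothesis ud : u * c_d T r0 s0 = e (c_l0 T r0).
Hypothesis du : c_d T r0 s0 * u = e (c_l0 T r0).

Let d := c_d T.
(** [U] is the pivot inverse as a map from degree 0 to degree -1. Then [N] vanishes on the pivot row
    and column, and its remaining block is the reduced differential. *)
Let U := sng s0 r0 u.
Let N := d - d *m U *m d.
Let P0 := P (c_l0 T) r0.
Let Q0 := Q (c_l0 T) r0.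
Let P1 := P (c_lm1 T) s0.
Let Q1 := Q (c_lm1 T) s0.
Let E0 := id_proj e (c_l0 T).
Let E1 := id_proj e (c_lm1 T).
Let D0 := sng r0 r0 (e (c_l0 T r0)).
Let D1 := sng s0 s0 (e (c_lm1 T s0)).

Let pmapU : pmap e S (c_lm1 T) (c_l0 T) U.
Proof.
move=> s r; rewrite mxE; case: ifP => [/andP[/eqP-> /eqP->]|_].
  by rewrite lab_eq uE -uE (csub_corner subS).
by rewrite mulr0 mul0r (csub0 subS).
Qed.

Let UdD : U *m d *m D1 = D1.
Proof. by rewrite sng_sng ud lab_eq eeE /D1 lab_eq. Qed.

Let DdU : D0 *m d *m U = D0.
Proof. by rewrite sng_sng -mulrA du eeE. Qed.

Let pmapN' : pmap e S (c_l0 T) (c_lm1 T) N.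
Proof. exact: pmapB vT (pmapM (pmapM vT pmapU) vT). Qed.

Let ND : N *m D1 = 0.
Proof. by rewrite mulmxBl -2!mulmxA UdD subrr. Qed.

Let DN : D0 *m N = 0.
Proof. by rewrite mulmxBr !mulmxA DdU subrr. Qed.

Let UQ : U *m Q0 = 0.
Proof.
apply/matrixP => i j; rewrite sng_mull !mxE (negPf (neq_lift _ _)) mulr0.
by case: ifP.
Qed.

Let PU : P1 *m U = 0.
Proof.
apply/matrixP => i j; rewrite sng_mulr !mxE [lift _ _ == _]eq_sym (negPf (neq_lift _ _)) mul0r.
by case: ifP.
Qed.

Let red_d : c_d (gauss_reduce r0 s0 u) = P0 *m N *m Q1.
Proof.
apply/matrixP => r s; rewrite [LHS]mxE.
(* [E0] and [E1] act as identities on [N], while [P0] and [Q1] consist of their rows and columns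
   away from the pivot. *)
transitivity ((E0 *m N *m E1) (lift r0 r) (lift s0 s)).
  rewrite (pmap_idl pmapN') (pmap_idr pmapN') /N -mulmxA [RHS]mxE.
  rewrite [X in _ = _ + X]mxE; congr (_ - _); rewrite mxE.
  rewrite (bigD1 s0) //= big1 ?addr0 => [|k ks]; rewrite sng_mull ?eqxx //.
  by rewrite (negPf ks) mulr0.
rewrite mxE [RHS]mxE; apply: eq_bigr => k _.
rewrite [Q1 _ _]mxE; congr (_ * _); rewrite mxE [RHS]mxE; apply: eq_bigr => j _.
by rewrite [P0 _ _]mxE.
Qed.

Lemma gauss_reduce_valid : valid_cplx e S (gauss_reduce r0 s0 u).
Proof.
by rewrite /valid_cplx red_d; apply: pmapM (pmapM (pmapP _ _) pmapN') (pmapQ _ _).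
Qed.

Lemma gauss_reduce_iso : isoK e S T (gauss_reduce r0 s0 u).
Proof.
(* The maps are the elementary operations [1 - d U] in degree 0 and [1 - U d] in degree -1 that
   clear the pivot row and column, combined with dropping or restoring the pivot summands. *)
exists (P0 - P0 *m d *m U), P1, Q0, (Q1 - U *m d *m Q1); split; [|split; [|split]].
- split; [|split; first exact: pmapP].
    by apply: pmapB (pmapP _ _) _; exact: pmapM (pmapM (pmapP _ _) vT) pmapU.
  transitivity (P0 *m N); first by rewrite mulmxBl mulmxBr !mulmxA.
  rewrite red_d -(mulmxA _ Q1) QP -(mulmxA P0); congr (_ *m _).
  by rewrite mulmxBr ND subr0 (pmap_idr pmapN').
- split; [exact: pmapQ|split].
    by apply: pmapB (pmapQ _ _) _; exact: pmapM (pmapM pmapU vT) (pmapQ _ _).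
  rewrite red_d !mulmxA QP mulmxBl -/D0 DN subr0 (pmap_idl pmapN').
  by rewrite mulmxBl mulmxBr !mulmxA.
(* On [T] the composite differs from the identity by [- d U] and [- U d]; on the reduced complex the
   composite is the identity itself. *)
- exists (- U); split; first exact: pmapN.
  rewrite mulmxN mulNmx; split.
    rewrite mulmxBr !mulmxA QP !mulmxBl DdU (pmap_idl vT) opprB addrA subrK.
    by rewrite addrAC subrr add0r.
  rewrite mulmxBl -(mulmxA _ Q1) QP mulmxBr UdD -(mulmxA U) (pmap_idr vT).
  by rewrite opprB addrA subrK addrAC subrr add0r.
- have -> : (P0 - P0 *m d *m U) *m Q0 = id_proj e (c_l0 (gauss_reduce r0 s0 u)).
    by rewrite mulmxBl PQ -(mulmxA _ U) UQ mulmx0 subr0.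
  have -> : P1 *m (Q1 - U *m d *m Q1) = id_proj e (c_lm1 (gauss_reduce r0 s0 u)).
    by rewrite mulmxBr PQ !mulmxA PU !mul0mx subr0.
  by rewrite !subrr; exact: null0.
Qed.

Lemma gauss_reduce_class (R : realType) :
  classK0 R (gauss_reduce r0 s0 u) = classK0 R T.
Proof.
rewrite /classK0 [in RHS](bigD1_ord r0) //= [X in _ = _ - X](bigD1_ord s0) //=.
by rewrite lab_eq opprD addrACA subrr add0r.
Qed.
End Reduction.

Hypothesis basic_e : basic_alg e.

Let JD := jradD orth_e.
Let JB := jradB orth_e.
Let Jsum := jrad_sum orth_e.
Let JMr := jradMr orth_e.
Let Joff i j x : i != j -> jrad e (e j * x * e i).
Proof. exact: jrad_offdiag. Qed.

(** * Minimal complexes *)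

Definition minimal_cplx T := forall r s, jrad e (c_d T r s).

(** Induction on the number of summands in degree 0. An entry outside the radical joins equal
    labels, as [A] is basic, and is then a unit of a local corner, so it can serve as a pivot. *)
Lemma minimal_cplx_exists T : valid_cplx e S T -> exists T',
  [/\ valid_cplx e S T', isoK e S T T', minimal_cplx T' &
      forall R : realType, classK0 R T' = classK0 R T].
Proof.
have [m] := ubnP (c_n0 T); elim: m T => // m IH T leTm vT.
have [minT|] := pselect (minimal_cplx T).
  by exists T; split=> //; exact: isoK_refl.
move=> /existsNP[r0] /existsNP[s0] Jd.
have [_ dE] := vT r0 s0.
have lab_eq : c_lm1 T s0 = c_l0 T r0.
  by apply/eqP/negPn/negP => /(@Joff _ _ (c_d T r0 s0)); rewrite dE.
rewrite lab_eq in dE; have [u uE [ud du]] := jradP orth_e dE Jd.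
have [] := IH (gauss_reduce r0 s0 u).
- by rewrite /= prednK ?(leq_ltn_trans _ (ltn_ord r0)).
- exact: gauss_reduce_valid.
move=> T' [vT' isoT' minT' clT']; exists T'; split=> //.
  exact: isoK_trans (gauss_reduce_iso vT lab_eq uE ud du) isoT'.
by move=> R; rewrite clT' gauss_reduce_class.
Qed.

(** A contraction writes the identities as products with the radical differential, so [T] has no
    summand in either degree. The zero homotopy then works over every subring, which lets
    contractibility pass from [S'] to [S]. *)
Lemma minimal_zeroK T (S' : pred A) :
  minimal_cplx T -> zeroK e S' T -> zeroK e S T.
Proof.
move=> minT [h [_ [h0 h1]]]; exists 0; split; first exact: pmap0.
split; apply/matrixP => r s.
  case: (jrad_e orth_e (i := c_l0 T r)).
  have -> : e (c_l0 T r) = id_proj e (c_l0 T) r r by rewrite mxE eqxx.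
  by rewrite h0 mxE; apply: Jsum => k _; apply: JMr.
case: (jrad_e orth_e (i := c_lm1 T r)).
have -> : e (c_lm1 T r) = id_proj e (c_lm1 T) r r by rewrite mxE eqxx.
by rewrite h1 mxE; apply: Jsum => k _; apply: jradMl.
Qed.

Lemma minimal_presilting_disjoint T r s : minimal_cplx T ->
  hom_shift1_zero e S T T -> c_l0 T r <> c_lm1 T s.
Proof.
move=> minT homT rs; apply: (jrad_e orth_e (i := c_l0 T r)).
(* The test map is the identity between the two equal summands and zero elsewhere. *)
have [i j|s0 [s1 [_ [_ gE]]]] := homT (sng r s (e (c_l0 T r))).
  rewrite mxE; case: ifP => [/andP[/eqP-> /eqP->]|_].
    by rewrite -rs !eeE csub_e.
  by rewrite mulr0 mul0r (csub0 subS).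
have -> : e (c_l0 T r) = sng r s (e (c_l0 T r)) r s by rewrite mxE !eqxx.
rewrite gE !mxE; apply: JB; apply: Jsum => k _; first exact: jradMl.
exact: JMr.
Qed.

(** In [id_U = f0 g0 - d_U h] the last term is radical. If no summand of [T] in degree 0 had the
    label of [r], row [r] of [f0] would be off-diagonal, hence radical too, and so would be an
    [e i]. *)
Lemma minimal_retract_labels0 T U r : minimal_cplx U -> retractK T U ->
  exists s, c_l0 T s = c_l0 U r.
Proof.
move=> minU [f0 [f1 [g0 [g1 [[f0P _] _ [h [_ [h0 _]]]]]]]].
apply: contrapT => noT; apply: (jrad_e orth_e (i := c_l0 U r)).
have -> : e (c_l0 U r) = id_proj e (c_l0 U) r r by rewrite mxE eqxx.
have -> : id_proj e (c_l0 U) = f0 *m g0 - c_d U *m h by rewrite -h0 subKr.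
rewrite !mxE; apply: JB; apply: Jsum => k _; apply: JMr => //.
have [_ <-] := f0P r k; apply: Joff.
by apply/eqP => E; apply: noT; exists k.
Qed.

Lemma minimal_retract_labelsm1 T U r : minimal_cplx U -> retractK T U ->
  exists s, c_lm1 T s = c_lm1 U r.
Proof.
move=> minU [f0 [f1 [g0 [g1 [[_ [f1P _]] _ [h [_ [_ h1]]]]]]]].
apply: contrapT => noT; apply: (jrad_e orth_e (i := c_lm1 U r)).
have -> : e (c_lm1 U r) = id_proj e (c_lm1 U) r r by rewrite mxE eqxx.
have -> : id_proj e (c_lm1 U) = f1 *m g1 - h *m c_d U by rewrite -h1 subKr.
rewrite !mxE; apply: JB; apply: Jsum => k _; last exact: jradMl.
apply: JMr; have [_ <-] := f1P r k; apply: Joff.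
by apply/eqP => E; apply: noT; exists k.
Qed.

(* Eliminating the diagonal entries of [1 + X] one by one shows that the
   two-term complex with differential [1 + X] is contractible. *)
Lemma jrad_matrix_invertible p (l : 'I_p -> 'I_n) (X : 'M[A]_p) :
  pmap e S l l X -> (forall r s, jrad e (X r s)) ->
  exists Y, [/\ pmap e S l l Y, (id_proj e l + X) *m Y = id_proj e l
              & Y *m (id_proj e l + X) = id_proj e l].
Proof.
(* When both terms carry the same labels, a contraction of the complex is exactly a two-sided
   inverse of its differential. *)
move=> XP JX; suff [h [hP [h0 h1]]] : zeroK e S (Cplx l l (id_proj e l + X)).
  by exists h.
elim: p l X XP JX => [|p IH] l X XP JX.
  by exists 0; split; [exact: pmap0|split; apply/matrixP => -[]].
pose T := Cplx l l (id_proj e l + X); pose z : 'I_p.+1 := ord0.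
have vT : valid_cplx e S T by apply: pmapD (pmap_id l) XP.
have [_ XE] := XP z z.
have [u uE [ud du]] := @jrad_unit _ _ _ _ orth_e (l z) _ (JX z z).
rewrite XE in ud du.
have dz : c_d T z z = e (l z) + X z z by rewrite /= mxE [id_proj _ _ _ _]mxE eqxx.
rewrite -dz in ud du.
have isoT := @gauss_reduce_iso T z z u vT erefl uE ud du.
have vT' := @gauss_reduce_valid T z z u vT erefl uE.
apply: zeroK_retract (isoK_retract (isoK_sym isoT)) _.
pose l' r := l (lift z r); pose X' : 'M_p := c_d (gauss_reduce (T := T) z z u) - id_proj e l'.
have -> : gauss_reduce (T := T) z z u = Cplx l' l' (id_proj e l' + X').
  by rewrite /X' addrC subrK.
apply: IH; first by apply: pmapB vT' (pmap_id _).
move=> r s; rewrite mxE [c_d _ _ _]mxE [c_d T _ (lift z s)]mxE.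
have -> : id_proj e l (lift z r) (lift z s) = id_proj e l' r s.
  by rewrite !mxE (inj_eq lift_inj).
rewrite [(- id_proj e l') _ _]mxE -(addrA (id_proj e l' r s)) addrC addKr.
(* The Schur correction starts with an entry of [1 + X] off the diagonal, which is an entry of [X];
   hence [X'] is radical again. *)
apply: JB => //; apply: JMr; rewrite mxE; apply: JD => //.
by rewrite mxE eq_sym (negPf (neq_lift _ _)); apply: jrad0.
Qed.

End HomotopyCategory.

(** * Sign-coherent complexes *)

Section SignDecomposition.
Variables (F : fieldType) (A : falgType F) (n : nat) (e : 'I_n -> A).
Variable eps : 'I_n -> int.
Hypothesis orth_e : complete_orth_prim e.
Hypothesis basic_e : basic_alg e.
Hypothesis eps_sign : forall i, eps i = 1 \/ eps i = -1.
Implicit Types T U V : cplx n A.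

Local Notation Ae := (A_eps e eps).

Lemma corner_subring_predT : corner_subring e predT.
Proof. by []. Qed.

Let eminus_mul i : eps i = 1 -> eminus e eps * e i = 0.
Proof.
move=> i1; rewrite mulr_suml big1 // => j /eqP j1; apply: (ee0 orth_e).
by apply: contra_eq_neq i1 => <-; rewrite j1.
Qed.

Let mul_eplus i : eps i = -1 -> e i * eplus e eps = 0.
Proof.
move=> i1; rewrite mulr_sumr big1 // => j /eqP j1; apply: (ee0 orth_e).
by apply: contra_eq_neq i1 => ->; rewrite j1.
Qed.

(** The pairs left out have [eps i = -1] and [eps j = 1]; they make up the corner [e- A e+] that
    [A_eps] kills. *)
Lemma mem_A_eps i j x : eps i = 1 \/ eps j = -1 -> e i * x * e j = x -> x \in Ae.
Proof.
move=> ij <-; rewrite inE /=; case: ij => [/eminus_mul|/mul_eplus] E0.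
  by rewrite !mulrA E0 !mul0r.
by rewrite -!mulrA E0 !mulr0.
Qed.

Lemma eplusDeminus : eplus e eps + eminus e eps = 1.
Proof.
have [<- _] := orth_e; rewrite /eplus /eminus [RHS](bigID (fun i => eps i == 1)) /=.
congr (_ + _); apply: eq_bigl => i.
by case: (eps_sign i) => ->.
Qed.

Lemma corner_subring_A_eps : corner_subring e Ae.
Proof.
split.
- by rewrite inE /= mulr0 mul0r.
- move=> x y; rewrite !inE /= => /eqP x0 /eqP y0.
  by rewrite mulrBr mulrBl x0 y0 subrr.
- move=> x y; rewrite !inE /= => /eqP x0 /eqP y0.
  (* Inserting [1 = e+ + e-] between [x] and [y] leaves two terms, one killed by the condition on
     [x] and one by that on [y]. *)
  rewrite -[x]mulr1 -eplusDeminus mulrDr mulrDl mulrDr mulrDl !mulrA x0 !mul0r add0r.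
  by rewrite -!mulrA [eminus _ _ * (y * _)]mulrA y0 !mulr0.
- move=> i x; apply: (@mem_A_eps i i); first exact: eps_sign.
  by rewrite !mulrA (ee orth_e) -!mulrA (ee orth_e).
Qed.

Let subT := corner_subring_predT.
Let subE := corner_subring_A_eps.

(** * Comparison of the homotopy categories over [A] and [A_eps] *)

Lemma pmap_predT S p q (l' : 'I_q -> 'I_n) (l : 'I_p -> 'I_n) M :
  pmap e S l' l M -> pmap e predT l' l M.
Proof. by move=> MP r s; have [_ ?] := MP r s. Qed.

Lemma pmap_A_eps p q (l' : 'I_q -> 'I_n) (l : 'I_p -> 'I_n) M :
  (forall r s, eps (l' r) = 1 \/ eps (l s) = -1) ->
  pmap e predT l' l M -> pmap e Ae l' l M.
Proof.
move=> ll MP r s; have [_ ME] := MP r s; split=> //.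
exact: mem_A_eps (ll r s) ME.
Qed.

Lemma chain_predT S T U f0 f1 :
  @chain_map _ _ _ e S T U f0 f1 -> @chain_map _ _ _ e predT T U f0 f1.
Proof. by move=> [/pmap_predT ? [/pmap_predT ? ?]]. Qed.

Lemma null_predT S T U f0 f1 :
  @null_homotopic _ _ _ e S T U f0 f1 -> @null_homotopic _ _ _ e predT T U f0 f1.
Proof. by move=> [h [/pmap_predT ? ?]]; exists h. Qed.

Lemma isoK_predT S T U : isoK e S T U -> isoK e predT T U.
Proof.
move=> [f0 [f1 [g0 [g1 [/chain_predT ? [/chain_predT ? []]]]]]].
by move=> /null_predT ? /null_predT ?; exists f0, f1, g0, g1.
Qed.

Lemma zeroK_predT S T : zeroK e S T -> zeroK e predT T.
Proof. exact: null_predT. Qed.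

(** A contraction over [A] need not have entries in [A_eps]. On a minimal representative over
    [A_eps], however, contractibility over [A] leaves no summand at all. *)
Lemma zeroK_A_eps T : valid_cplx e Ae T -> zeroK e predT T -> zeroK e Ae T.
Proof.
move=> vT zT; have [T' [_ isoT minT _]] := minimal_cplx_exists orth_e subE basic_e vT.
apply: (zeroK_retract orth_e subE (isoK_retract (isoK_sym isoT))).
apply: (@minimal_zeroK _ _ _ _ orth_e _ subE _ predT minT).
exact: (zeroK_retract orth_e subT (isoK_retract (isoK_predT isoT)) zT).
Qed.

Definition eps_cplx T :=
  (forall r, eps (c_l0 T r) = 1) /\ (forall s, eps (c_lm1 T s) = -1).

Lemma eps_cplx_dsum T U : eps_cplx T -> eps_cplx U -> eps_cplx (dsum T U).
Proof.
by move=> [T0 T1] [U0 U1]; split=> k /=; rewrite /lab_sum; case: (split k).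
Qed.

Lemma valid_A_eps T : eps_cplx T -> valid_cplx e predT T -> valid_cplx e Ae T.
Proof. by move=> [T0 _] vT; apply: pmap_A_eps vT => r s; left. Qed.

Lemma hom_shift1_A_eps T U : eps_cplx T -> eps_cplx U ->
  hom_shift1_zero e Ae T U <-> hom_shift1_zero e predT T U.
Proof.
move=> [T0 T1] [U0 U1]; split=> homT g gP.
  have [|s0 [s1 [s0P [s1P gE]]]] := homT g; first by apply: pmap_A_eps gP => r s; left.
  by exists s0, s1; split; [exact: pmap_predT s0P|split; [exact: pmap_predT s1P|]].
have [s0 [s1 [s0P [s1P gE]]]] := homT g (pmap_predT gP).
exists s0, s1; split; first by apply: pmap_A_eps s0P => r s; left.
by split=> //; apply: pmap_A_eps s1P => r s; right.
Qed.

(** Labels in the two degrees have opposite signs, so every entry of the differential is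
    off-diagonal. *)
Lemma eps_cplx_minimal T : eps_cplx T -> valid_cplx e predT T -> minimal_cplx e T.
Proof.
move=> [T0 T1] vT r s; have [_ <-] := vT r s; apply: jrad_offdiag => //.
by apply: contra_eq_neq (T0 r) => <-; rewrite T1.
Qed.

(** Both [g f] and [f g] are the identity plus a radical matrix, hence invertible, with inverses [Y]
    and [Z]. So [Y g] is a left and [g Z] a right inverse of [f], and the two agree. *)
Lemma jrad_inverse p q (l : 'I_p -> 'I_n) (l' : 'I_q -> 'I_n)
    (f : 'M[A]_(q, p)) (g : 'M[A]_(p, q)) :
  pmap e predT l' l f -> pmap e predT l l' g ->
  (forall r s, jrad e ((g *m f - id_proj e l) r s)) ->
  (forall r s, jrad e ((f *m g - id_proj e l') r s)) ->
  exists k, [/\ pmap e predT l l' k, k *m f = id_proj e l & f *m k = id_proj e l'].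
Proof.
move=> fP gP Jgf Jfg.
have gfP := pmapM orth_e subT gP fP; have fgP := pmapM orth_e subT fP gP.
have idP p0 (l0 : 'I_p0 -> 'I_n) := pmap_id orth_e subT l0.
have [Y [YP _]] := jrad_matrix_invertible orth_e subT
  (pmapB subT gfP (idP _ l)) Jgf.
have [Z [ZP + _]] := jrad_matrix_invertible orth_e subT
  (pmapB subT fgP (idP _ l')) Jfg.
rewrite ![id_proj e _ + _]addrC !subrK => fgZ Ygf.
have kf : Y *m g *m f = id_proj e l by rewrite -mulmxA.
have kP := pmapM orth_e subT YP gP.
exists (Y *m g); split=> //.
have -> : Y *m g = g *m Z.
  rewrite -(pmap_idr orth_e kP) -fgZ !mulmxA kf.
  by rewrite (pmap_idl orth_e gP).
by rewrite mulmxA.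
Qed.

(** The homotopies over [A] have entries in [e- A e+], which [A_eps] lacks. As the differentials are
    radical, [f0] and [f1] are invertible modulo the radical, hence strictly; replacing the homotopy
    inverse by the strict one removes the need for homotopies. *)
Lemma isoK_A_eps T U : eps_cplx T -> eps_cplx U ->
  valid_cplx e predT T -> valid_cplx e predT U ->
  isoK e predT T U -> isoK e Ae T U.
Proof.
move=> epsT epsU vT vU.
move=> [f0 [f1 [g0 [g1 [[f0P [f1P fE]] [[g0P [g1P _]] []]]]]]].
move=> [h [_ [h0 h1]]] [h' [_ [h0' h1']]].
have minT := eps_cplx_minimal epsT vT; have minU := eps_cplx_minimal epsU vU.
have Jl p q r (M : 'M[A]_(p, q)) (N : 'M[A]_(q, r)) :
    (forall i j, jrad e (M i j)) -> forall i j, jrad e ((M *m N) i j).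
  move=> JM i j; rewrite mxE; apply: jrad_sum => // k _.
  exact: jradMr.
have Jr p q r (M : 'M[A]_(p, q)) (N : 'M[A]_(q, r)) :
    (forall i j, jrad e (N i j)) -> forall i j, jrad e ((M *m N) i j).
  move=> JM i j; rewrite mxE; apply: jrad_sum => // k _.
  exact: jradMl.
have [|r s|k0 [k0P k0f fk0]] := jrad_inverse f0P g0P.
- by rewrite h0; apply: Jl.
- by rewrite h0'; apply: Jl.
have [|r s|k1 [k1P k1f fk1]] := jrad_inverse f1P g1P.
- by rewrite h1; apply: Jr.
- by rewrite h1'; apply: Jr.
have [T0 T1] := epsT; have [U0 U1] := epsU.
exists f0, f1, k0, k1; split; [|split; [|split]].
- split; first by apply: pmap_A_eps f0P => r s; left.
  by split=> //; apply: pmap_A_eps f1P => r s; right.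
- split; first by apply: pmap_A_eps k0P => r s; left.
  split; first by apply: pmap_A_eps k1P => r s; right.
  (* The inverses commute with the differentials: [k0 d_U = k0 d_U f1 k1 = k0 f0 d_T k1 = d_T
     k1]. *)
  rewrite -[c_d U](pmap_idr orth_e vU) -fk1 !mulmxA -(mulmxA k0) -fE mulmxA k0f.
  by rewrite (pmap_idl orth_e vT).
- by rewrite k0f k1f !subrr; apply: null0.
- by rewrite fk0 fk1 !subrr; apply: null0.
Qed.

Lemma indecK_A_eps T : eps_cplx T -> indecK e predT T -> indecK e Ae T.
Proof.
move=> epsT [vT [nzT indT]]; split; first exact: valid_A_eps.
split=> [/zeroK_predT//|U V vU vV /isoK_predT isoT].
have [||zU|zV] := indT U V _ _ isoT; try exact: pmap_predT.
  by left; apply: zeroK_A_eps.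
by right; apply: zeroK_A_eps.
Qed.

Lemma eps_cplx_retract T U : eps_cplx T -> minimal_cplx e U ->
  retractK e predT T U -> eps_cplx U.
Proof.
move=> [T0 T1] minU TU; split=> r.
  by have [s <-] := minimal_retract_labels0 orth_e basic_e r minU TU.
by have [s <-] := minimal_retract_labelsm1 orth_e basic_e r minU TU.
Qed.

(** The summands of a decomposition over [A] need not be complexes over [A_eps]. Their minimal
    representatives are retracts of [T], hence have the signs of [eps], and the decomposition
    descends to [A_eps]. *)
Lemma indecK_of_A_eps T : eps_cplx T -> indecK e Ae T -> indecK e predT T.
Proof.
move=> epsT [vT [nzT indT]]; have vT' := pmap_predT vT.
split=> //; split=> [/(zeroK_A_eps vT)//|U V vU vV isoT].
have [U' [vU' isoU minU _]] := minimal_cplx_exists orth_e subT basic_e vU.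
have [V' [vV' isoV minV _]] := minimal_cplx_exists orth_e subT basic_e vV.
have isoT' := isoK_trans orth_e subT isoT (isoK_dsum subT isoU isoV).
have TUV := isoK_retract isoT'.
have epsU : eps_cplx U'.
  apply: eps_cplx_retract epsT minU _.
  exact: (retractK_trans orth_e subT TUV (retractK_dsuml orth_e subT _ vU')).
have epsV : eps_cplx V'.
  apply: eps_cplx_retract epsT minV _.
  exact: (retractK_trans orth_e subT TUV (retractK_dsumr orth_e subT _ vV')).
have vUV : valid_cplx e predT (dsum U' V') by apply/valid_dsum.
have [||zU|zV] := indT U' V' _ _ (isoK_A_eps epsT (eps_cplx_dsum epsU epsV) vT' vUV isoT').
- exact: valid_A_eps.
- exact: valid_A_eps.
- left; apply: (zeroK_retract orth_e subT (isoK_retract (isoK_sym isoU))).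
  exact: zeroK_predT zU.
- right; apply: (zeroK_retract orth_e subT (isoK_retract (isoK_sym isoV))).
  exact: zeroK_predT zV.
Qed.

Lemma indecK_iso S T T' : corner_subring e S -> valid_cplx e S T' ->
  isoK e S T T' -> indecK e S T -> indecK e S T'.
Proof.
move=> subS vT' isoT [vT [nzT indT]]; split=> //; split.
  by move/(zeroK_retract orth_e subS (isoK_retract (isoK_sym isoT))).
by move=> U V vU vV isoT'; apply: indT => //; exact: isoK_trans isoT isoT'.
Qed.

(** * Cones in the orthant and equality of the two fans *)

Section Cones.
Variable R : realType.

Lemma cone_gen (vs : seq 'rV[R]_n) i : (i < size vs)%N -> cone vs vs`_i.
Proof.
move=> ivs; exists (fun k => (k == i)%:R); split; first by move=> k; apply: ler0n.
rewrite (bigD1 (Ordinal ivs)) //= eqxx scale1r big1 ?addr0 // => k /eqP ki.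
by case: eqP => [E|_]; [case: ki; apply: val_inj|rewrite scale0r].
Qed.

Lemma orthant_coord (v : 'rV[R]_n) i : orthant eps v -> 0 <= (eps i)%:~R * v 0 i.
Proof.
move=> [a [a_ge0 ->]]; rewrite summxE mulr_sumr; apply: sumr_ge0 => k _.
have kn : (k < size (enum 'I_n))%N by have := ltn_ord k; rewrite {2}size_map.
rewrite (nth_map i) // !mxE eqxx /=; set j := nth _ _ _.
have [->|_] := eqVneq i j; last by rewrite !mulr0.
rewrite mulr1 mulrCA mulr_ge0 // -intrM.
by case: (eps_sign j) => ->.
Qed.

(** With no label in both degrees nothing cancels in the class: its coordinate at a label is a
    positive count in degree 0 and a negative one in degree -1, and the orthant dictates the
    sign. *)
Lemma class_eps_cplx T : (forall r s, c_l0 T r <> c_lm1 T s) ->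
  orthant eps (classK0 R T) -> eps_cplx T.
Proof.
move=> disj clT.
have coord i : classK0 R T 0 i =
    \sum_r (c_l0 T r == i)%:R - \sum_s (c_lm1 T s == i)%:R.
  rewrite !mxE !summxE; congr (_ - _); apply: eq_bigr => r _;
  by rewrite mxE eqxx eq_sym.
split=> r.
  have := orthant_coord (c_l0 T r) clT; rewrite coord [X in _ - X]big1 => [|s _].
    rewrite subr0 (bigD1 r) //= eqxx.
    have pos : 0 < 1 + \sum_(i | i != r) (c_l0 T i == c_l0 T r)%:R :> R.
      by rewrite ltr_pwDl ?sumr_ge0.
    case: (eps_sign (c_l0 T r)) => [//|->].
    by rewrite mulN1r oppr_ge0 leNgt pos.
  by case: eqP => // E; case: (disj r s).
have := orthant_coord (c_lm1 T r) clT; rewrite coord [X in X - _]big1 => [|s _].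
  rewrite sub0r (bigD1 r) //= eqxx.
  have pos : 0 < 1 + \sum_(i | i != r) (c_lm1 T i == c_lm1 T r)%:R :> R.
    by rewrite ltr_pwDl ?sumr_ge0.
  case: (eps_sign (c_lm1 T r)) => [->|//].
  by rewrite mul1r oppr_ge0 leNgt pos.
by case: eqP => // E; case: (disj s r).
Qed.

Local Notation "Ts `[ i ]" := (nth (zero_cplx A n) Ts i) (at level 2, format "Ts `[ i ]").

(** Each generator is replaced by a minimal complex of the same class, so the cone does not
    change. *)
Lemma Sigma_eps_representatives S sigma : corner_subring e S ->
  Sigma_eps (R := R) e S eps sigma ->
  exists Ts : seq (cplx n A),
    [/\ forall i, (i < size Ts)%N -> eps_cplx Ts`[i] /\ indecK e S Ts`[i],
        forall i j, (i < size Ts)%N -> (j < size Ts)%N -> i != j ->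
          ~ isoK e S Ts`[i] Ts`[j],
        forall i j, (i < size Ts)%N -> (j < size Ts)%N ->
          hom_shift1_zero e S Ts`[i] Ts`[j] &
        sigma = cone (map (@classK0 _ A n R) Ts)].
Proof.
move=> subS [[Ts [indTs [isoTs [/(presilting_dsum_seq orth_e subS)[vTs homTs] ->]]]] orth].
(* Choice yields a function on all complexes, ready for [map]; on invalid ones the requirement is
   vacuous. *)
have /choice[m mP] : forall T, exists T', valid_cplx e S T ->
    [/\ valid_cplx e S T', isoK e S T T', minimal_cplx e T' &
        forall R : realType, classK0 R T' = classK0 R T].
  move=> T; have [vT|nvT] := pselect (valid_cplx e S T); last by exists T.
  by have [T' T'P] := minimal_cplx_exists orth_e subS basic_e vT; exists T'.
have classE : map (@classK0 _ A n R) (map m Ts) = map (@classK0 _ A n R) Ts.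
  rewrite -map_comp; apply: (@eq_from_nth _ 0); rewrite !size_map // => i iTs.
  rewrite !(nth_map (zero_cplx A n)) //=.
  by have [_ _ _ ->] := mP _ (vTs i iTs).
have homm i j : (i < size Ts)%N -> (j < size Ts)%N ->
    hom_shift1_zero e S (m Ts`[i]) (m Ts`[j]).
  move=> iTs jTs; have [_ isoi _ _] := mP _ (vTs i iTs).
  have [_ isoj _ _] := mP _ (vTs j jTs).
  apply: (hom_shift1_retractl orth_e subS (isoK_retract isoi)).
  apply: (hom_shift1_retractr orth_e subS (isoK_retract isoj)).
  exact: homTs.
exists (map m Ts); rewrite size_map classE; split=> //.
- move=> i iTs; rewrite (nth_map (zero_cplx A n)) //.
  have [vi isoi mini cli] := mP _ (vTs i iTs); split; last first.
    exact: indecK_iso (indTs i iTs).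
  apply: class_eps_cplx.
    by move=> r s; apply: minimal_presilting_disjoint (homm i i iTs iTs).
  (* The class is a generator of the cone, so it lies in the orthant together with the cone. *)
  rewrite cli; apply: orth; rewrite -(nth_map _ 0) //.
  by apply: cone_gen; rewrite size_map.
- move=> i j iTs jTs ij; rewrite !(nth_map (zero_cplx A n)) // => isom.
  have [_ isoi _ _] := mP _ (vTs i iTs); have [_ isoj _ _] := mP _ (vTs j jTs).
  apply: (isoTs i j iTs jTs ij).
  apply: (isoK_trans orth_e subS isoi); apply: (isoK_trans orth_e subS isom).
  exact: isoK_sym.
- by move=> i j iTs jTs; rewrite !(nth_map (zero_cplx A n)) //; apply: homm.
Qed.

(** One list of sign-coherent complexes presents the cone on both sides: reading the same matrices
    over [A] is the functor [- (x) A]. *)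
Lemma Sigma_eps_A_eps : Sigma_eps (R := R) e Ae eps = Sigma_eps (R := R) e predT eps.
Proof.
apply/seteqP; split=> sigma sigmaP.
  have [Ts [epsTs isoTs homTs sigmaE]] := Sigma_eps_representatives subE sigmaP.
  split; last by case: sigmaP.
  have vTs i : (i < size Ts)%N -> valid_cplx e predT Ts`[i].
    by move=> /epsTs[_ [vi _]]; apply: pmap_predT vi.
  exists Ts; split; first by move=> i /epsTs[? ?]; apply: indecK_of_A_eps.
  split.
    move=> i j iTs jTs ij isoij; apply: (isoTs i j iTs jTs ij).
    by apply: isoK_A_eps isoij; do ?[exact: vTs]; apply epsTs.
  split=> //; apply/presilting_dsum_seq => //; split=> // i j iTs jTs.
  by apply/hom_shift1_A_eps; do ?[exact: homTs]; apply epsTs.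
have [Ts [epsTs isoTs homTs sigmaE]] := Sigma_eps_representatives subT sigmaP.
split; last by case: sigmaP.
exists Ts; split; first by move=> i /epsTs[? ?]; apply: indecK_A_eps.
split; first by move=> i j iTs jTs ij /isoK_predT; apply: isoTs.
split=> //; apply/presilting_dsum_seq => //; split=> [i /epsTs[? [? _]]|i j iTs jTs].
  exact: valid_A_eps.
by apply/hom_shift1_A_eps; do ?[exact: homTs]; apply epsTs.
Qed.
End Cones.
End SignDecomposition.

(* The map [e_i A_eps] |-> [e_i A] is the identity matrix in the bases
   ([e_i A_eps])_i and ([e_i A])_i of Z^n. *)
Theorem theorem4p23 (F : fieldType) (A : falgType F) (n : nat)
  (e : 'I_n -> A) (eps : 'I_n -> int) (R : realType) :
  complete_orth_prim e -> basic_alg e ->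
  (forall i, eps i = 1 \/ eps i = -1) ->
  fan_iso 1%:M (Sigma_eps (R := R) e (A_eps e eps) eps)
    (Sigma_eps (R := R) e predT eps).
Proof.
(* Both fans are now the same set of cones, and the identity map is to be checked. *)
move=> orth_e basic_e eps_sign; rewrite Sigma_eps_A_eps // /fan_iso.
rewrite map_mx1; under eq_fun do rewrite mulmx1.
split; first exact: unitmx1.
split=> [sigma|tau tauP]; first by rewrite image_id.
exists tau; split; first by rewrite image_id.
by move=> sigma [_]; rewrite image_id.
Qed.
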